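(* Let $\mathbf{A}\in\mathbb{R}^{n\times n}$ be a symmetric positive semidefinite matrix with minimum eigenvalue $\mu\ge0$ and maximum eigenvalue $L>0$, let $\mathbf{b}\in\mathbb{R}^n$, and let $f(\mathbf{x})=\frac12\langle\mathbf{A}\mathbf{x},\mathbf{x}\rangle-\langle\mathbf{b},\mathbf{x}\rangle$. Let $\mathbf{x}^*$ be a minimizer of $f$ over $\mathbb{R}^n$, and let $\mathbf{x}_0\in\mathbb{R}^n$. Let $\{\mathbf{y}_k\}_{k\ge1}$ be the iterates of the method of conjugate gradients started at $\mathbf{x}_0$, i.e. $$\mathbf{y}_k=\operatorname*{argmin}_{\mathbf{x}\in\mathbf{x}_0+\mathcal{K}_k}f(\mathbf{x}),\qquad \mathcal{K}_k=\mathrm{Lin}\{\mathbf{A}(\mathbf{x}_0-\mathbf{x}^* ),\mathbf{A}^2(\mathbf{x}_0-\mathbf{x}^* ),\dots,\mathbf{A}^k(\mathbf{x}_0-\mathbf{x}^* )\},\qquad k\ge1.$$ Then for every integer $k\ge1$, $$f(\mathbf{y}_k)-f(\mathbf{x}^* )\le\min\Big\{\frac{4}{(k+1)(k+2)},\Big(1-\sqrt{\tfrac{\mu}{L}}\Big)^k\Big\}\frac{(L-\mu)\|\mathbf{x}^*-\mathbf{x}_0\|^2}{2}.$$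
   Context: $\|\cdot\|$ is the standard Euclidean norm, $\langle\cdot,\cdot\rangle$ the standard inner product, and $\mathrm{Lin}$ denotes linear span. The method is considered in exact (infinite precision) arithmetic. *)

(* Defs.v *)
From HB Require Import structures.
From mathcomp Require Import all_boot all_order all_algebra.
From mathcomp Require Import classical_sets reals.

Set Implicit Arguments.
Unset Strict Implicit.
Unset Printing Implicit Defensive.

Import Order.TTheory GRing.Theory Num.Theory.

Local Open Scope classical_set_scope.
Local Open Scope ring_scope.

Section Euclidean.
Context {R : realType} {n : nat}.
Implicit Types (A : 'M[R]_n) (b u v x : 'cV[R]_n).

Definition dotv u v : R := \sum_(i < n) u i 0 * v i 0.

Definition enorm u : R := Num.sqrt (dotv u u).

Definition psdmx A : Prop := forall x, 0 <= dotv (A *m x) x.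

(* [eigenvalue] is defined through left (row) eigenvectors; a matrix and its
   transpose have the same eigenvalues. *)
Definition min_eigenvalue A (mu : R) : Prop :=
  eigenvalue A mu /\ forall a, eigenvalue A a -> mu <= a.

Definition max_eigenvalue A (L : R) : Prop :=
  eigenvalue A L /\ forall a, eigenvalue A a -> a <= L.

Definition quad A b x : R := 2^-1 * dotv (A *m x) x - dotv b x.

Definition krylov A v (k : nat) : {vspace 'cV[R]_n} :=
  <<[seq A ^+ i *m v | i <- iota 1 k]>>%VS.

End Euclidean.

Definition argmin {R : realType} {T : Type} (f : T -> R) (S : set T) : set T :=
  [set x | S x /\ forall z, S z -> f x <= f z].

(* For A symmetric positive semidefinite the objective is strictly convex on
   x0 + krylov: when i >= 1 the vectors A ^+ i *m v lie in the range of
   A, which meets the kernel of A only in 0.  So [argmin]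
   has at most one element here, and membership in it is the equation
   y k = argmin. *)
Definition cg_iterates {R : realType} {n : nat} (A : 'M[R]_n)
    (b xs x0 : 'cV[R]_n) (y : nat -> 'cV[R]_n) : Prop :=
  forall k, (1 <= k)%N ->
    argmin (quad A b) [set x0 + v | v in [set` krylov A (x0 - xs) k]] (y k).

(* Main.v *)
Require Import Defs.
From HB Require Import structures.
From mathcomp Require Import all_boot all_order all_algebra.
From mathcomp Require Import classical_sets reals.
From mathcomp Require Import zify ring lra.

Set Implicit Arguments.
Unset Strict Implicit.
Unset Printing Implicit Defensive.

Import Order.TTheory GRing.Theory Num.Theory.

Local Open Scope classical_set_scope.
Local Open Scope ring_scope.

(** With [e = x0 - xs], every polynomial [p] of degree at most [k] with
    [p(0) = 1] bounds the gap by [<A p(A) e, p(A) e> / 2], so it suffices to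
    choose [p] with [C - x p(x)^2] positive semidefinite at [A] for a small [C].
    No spectral theorem is needed: this positivity is read off from Pell-type
    identities for Chebyshev polynomials, which write [C - x p^2] as a sum of
    squares weighted by [L - x] and [(x - mu) (L - x)].  The odd Chebyshev
    polynomials give [C = L / (2k+1)^2], those shifted to [[mu, L]] give
    [C = 4 L ((1 - s) / (1 + s))^(2k)] with [s = sqrt (mu / L)], and for each of
    the two claimed rates one of these constants is small enough, unless
    [mu = L], where [p = 1 - x / L] gives [C = 0]. *)

(** * Inner product and bounds on quadratic forms *)

Section InnerProduct.
Context {R : realType} {n : nat}.
Implicit Types (A B : 'M[R]_n) (u v w x : 'cV[R]_n).

Lemma dotvE u v : dotv u v = (u^T *m v) 0 0.
Proof. by rewrite mxE; apply: eq_bigr => i _; rewrite mxE. Qed.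

Lemma dotvC u v : dotv u v = dotv v u.
Proof. by apply: eq_bigr => i _; rewrite mulrC. Qed.

Lemma dotvDl u v w : dotv (u + v) w = dotv u w + dotv v w.
Proof. by rewrite !dotvE linearD mulmxDl mxE. Qed.

Lemma dotvZl a u v : dotv (a *: u) v = a * dotv u v.
Proof. by rewrite !dotvE linearZ -scalemxAl mxE. Qed.

Lemma dotvDr u v w : dotv u (v + w) = dotv u v + dotv u w.
Proof. by rewrite dotvC dotvDl !(dotvC u). Qed.

Lemma dotvZr a u v : dotv u (a *: v) = a * dotv u v.
Proof. by rewrite dotvC dotvZl dotvC. Qed.

Lemma dotvNl u v : dotv (- u) v = - dotv u v.
Proof. by rewrite -scaleN1r dotvZl mulN1r. Qed.

Lemma dotv_mull A u v : dotv (A *m u) v = dotv u (A^T *m v).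
Proof. by rewrite !dotvE trmx_mul mulmxA. Qed.

Lemma dotv_ge0 u : 0 <= dotv u u.
Proof. by apply: sumr_ge0 => i _; rewrite -expr2 sqr_ge0. Qed.

Lemma dotv_eq0 u : (dotv u u == 0) = (u == 0).
Proof.
apply/idP/eqP => [|->]; last by rewrite /dotv big1 // => i _; rewrite mxE mul0r.
rewrite psumr_eq0 => [/allP u0|i _]; last by rewrite -expr2 sqr_ge0.
apply/matrixP => i j; rewrite ord1 mxE; apply/eqP.
by have := u0 i (mem_index_enum i); rewrite implyTb mulf_eq0 orbb.
Qed.

Lemma enormK u : enorm u ^+ 2 = dotv u u.
Proof. by rewrite sqr_sqrtr ?dotv_ge0. Qed.

Lemma psdmx_scalarB A a :
  psdmx (a%:M - A) <-> forall x, dotv (A *m x) x <= a * dotv x x.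
Proof.
by split=> h x; have := h x;
  rewrite mulmxBl mul_scalar_mx dotvDl dotvNl dotvZl subr_ge0.
Qed.

Lemma psdmx_scalarN A a :
  psdmx (A - a%:M) <-> forall x, a * dotv x x <= dotv (A *m x) x.
Proof.
by split=> h x; have := h x;
  rewrite mulmxBl mul_scalar_mx dotvDl dotvNl dotvZl subr_ge0.
Qed.

(** Each product [x_i x_j] is at most [|x|^2] in modulus, so the sum of the moduli of the entries
    works; adding 1 keeps [K] positive when [A] is zero. *)
Lemma quadratic_form_bounded A : exists2 K : R, 0 < K & psdmx (K%:M - A).
Proof.
pose S := \sum_i \sum_j `|A i j|.
have S0 : 0 <= S by apply: sumr_ge0 => i _; apply: sumr_ge0.
exists (S + 1); first by rewrite ltr_wpDl.
apply/psdmx_scalarB => x; apply: (@le_trans _ _ (S * dotv x x)); last first.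
  by rewrite ler_wpM2r ?dotv_ge0 // lerDl.
have sq i : x i 0 ^+ 2 <= dotv x x.
  rewrite /dotv (bigD1 i) //= expr2 lerDl.
  by apply: sumr_ge0 => j _; rewrite -expr2 sqr_ge0.
rewrite /dotv mulr_suml -/(dotv x x); apply: ler_sum => i _.
rewrite mxE !mulr_suml; apply: ler_sum => j _.
rewrite -mulrA; apply: le_trans (ler_norm _) _.
rewrite normrM ler_wpM2l // ler_norml.
by have := sq i; have := sq j; have := sqr_ge0 (x i 0 - x j 0);
  have := sqr_ge0 (x i 0 + x j 0); nra.
Qed.

Lemma eigenvalue_opp A a : eigenvalue (- A) a = eigenvalue A (- a).
Proof.
rewrite /eigenvalue /eigenspace (_ : - A - a%:M = - (A - (- a)%:M)).
  by rewrite !kermx_eq0 /row_free mxrank_opp.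
by rewrite raddfN /= opprK opprD.
Qed.

End InnerProduct.

(** * Positivity of polynomials in a symmetric matrix *)

Section PositiveFunctionalCalculus.
Context {R : realType} {m : nat}.
Variable A : 'M[R]_m.+1.
Hypothesis A_sym : A^T = A.
Implicit Types (p q r : {poly R}) (e : 'cV[R]_m.+1).

Definition quad_form q e : R := dotv (horner_mx A q *m e) e.

Definition psd_poly q : Prop := psdmx (horner_mx A q).

Lemma trmx_horner_mx q : (horner_mx A q)^T = horner_mx A q.
Proof.
elim/poly_ind: q => [|q c IH]; first by rewrite rmorph0 trmx0.
rewrite rmorphD rmorphM /= horner_mx_X horner_mx_C linearD /= tr_scalar_mx.
by rewrite -mulmxE trmx_mul A_sym IH (comm_mx_horner q (comm_mx_refl A)).
Qed.

Lemma quad_formD q r e : quad_form (q + r) e = quad_form q e + quad_form r e.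
Proof. by rewrite /quad_form rmorphD mulmxDl dotvDl. Qed.

Lemma quad_formC c e : quad_form c%:P e = c * dotv e e.
Proof. by rewrite /quad_form horner_mx_C mul_scalar_mx dotvZl. Qed.

(** [r(A)] is symmetric and commutes with [q(A)], so one of the two factors [r(A)] moves across the
    inner product. *)
Lemma quad_form_sqr q r e :
  quad_form (q * r ^+ 2) e = quad_form q (horner_mx A r *m e).
Proof.
rewrite /quad_form [RHS]dotvC [RHS]dotv_mull trmx_horner_mx [RHS]dotvC !mulmxA.
congr (dotv (_ *m e) e).
by rewrite !mulmxE -!rmorphM; congr (horner_mx A _); ring.
Qed.

Lemma psd_polyD q r : psd_poly q -> psd_poly r -> psd_poly (q + r).
Proof.
move=> hq hr e; rewrite -/(quad_form (q + r) e) quad_formD.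
by rewrite addr_ge0 //; [apply: hq | apply: hr].
Qed.

Lemma psd_poly_sqr q r : psd_poly q -> psd_poly (q * r ^+ 2).
Proof.
by move=> hq e; rewrite -/(quad_form (q * r ^+ 2) e) quad_form_sqr; apply: hq.
Qed.

Lemma psd_polyZ c q : 0 <= c -> psd_poly q -> psd_poly (c *: q).
Proof.
move=> c0 hq e; rewrite linearZ /= -scalemxAl dotvZl mulr_ge0 //; exact: hq.
Qed.

Lemma psd_poly1 : psd_poly 1.
Proof. by move=> e; rewrite rmorph1 mul1mx dotv_ge0. Qed.

(* [K q (K - q) = q (K - q)^2 + (K - q) q^2] *)
Lemma psd_poly_bound K q : 0 < K -> psd_poly q -> psd_poly (K%:P - q) ->
  psd_poly (q * (K%:P - q)).
Proof.
move=> K0 hq hKq.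
have -> : q * (K%:P - q) = K^-1 *: (q * (K%:P - q) ^+ 2 + (K%:P - q) * q ^+ 2).
  rewrite -mul_polyC [X in _ = _ * X](_ : _ = K%:P * (q * (K%:P - q))).
    by rewrite mulrA -polyCM mulVf ?gt_eqF// mul1r.
  by ring.
apply: psd_polyZ; first by rewrite invr_ge0 ltW.
by apply: psd_polyD; apply: psd_poly_sqr.
Qed.

End PositiveFunctionalCalculus.

(** * Extreme eigenvalues as bounds of the quadratic form *)

(** Bounding [invmx B] gives [|x|^2 <= K' |B x|^2], and [B ^+ 2 <= K B] gives
    [|B x|^2 <= K <B x, x>]. *)
Lemma psdmx_strict (R : realType) (m : nat) (B : 'M[R]_m.+1) :
  B^T = B -> psdmx B -> B \in unitmx ->
  exists2 c : R, 0 < c & psdmx (B - c%:M).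
Proof.
move=> B_sym B_psd B_unit.
have [K K0 hK] := quadratic_form_bounded B.
have [K' K'0 hK'] := quadratic_form_bounded ((invmx B)^T *m invmx B).
have BB x : dotv (B *m x) (B *m x) <= K * dotv (B *m x) x.
  have := @psd_poly_bound _ _ B B_sym K 'X K0.
  rewrite /psd_poly rmorphM !rmorphB /= horner_mx_X horner_mx_C.
  move=> /(_ B_psd hK x).
  rewrite -mulmxE -mulmxA.
  rewrite mulmxBl mulmxBr !mul_scalar_mx -scalemxAr dotvDl dotvNl.
  by rewrite dotvZl subr_ge0 [X in X <= _](dotv_mull B) B_sym.
exists (K' * K)^-1; first by rewrite invr_gt0 mulr_gt0.
apply/psdmx_scalarN => x; rewrite ler_pdivrMl ?mulr_gt0// -mulrA.
apply: le_trans (ler_wpM2l (ltW K'0) (BB x)).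
move/psdmx_scalarB: hK' => /(_ (B *m x)).
by rewrite -!mulmxA mulKmx// dotv_mull trmxK mulKmx// dotvC.
Qed.

(* The least [t] with [t - A] positive semidefinite is an eigenvalue: otherwise
   [t - A] is invertible, hence bounded below, and [t] can be decreased. *)
Lemma psdmx_max_eigenvalue (R : realType) (m : nat) (A : 'M[R]_m.+1) (L : R) :
  A^T = A -> (forall a, eigenvalue A a -> a <= L) -> psdmx (L%:M - A).
Proof.
move=> A_sym A_L.
pose S := [set t : R | psdmx (t%:M - A)].
have [K K0 hK] := quadratic_form_bounded A.
pose e : 'cV[R]_m.+1 := delta_mx 0 0.
have e1 : 0 < dotv e e.
  rewrite lt_def dotv_ge0 dotv_eq0 andbT; apply/eqP => /matrixP /(_ 0 0).
  by rewrite !mxE !eqxx /= => /eqP; rewrite oner_eq0.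
have S0 : S !=set0 by exists K.
have lbS : has_lbound S.
  exists (dotv (A *m e) e / dotv e e) => t /psdmx_scalarB /(_ e).
  by rewrite ler_pdivrMr.
pose M := inf S.
(* The infimum is attained: the Rayleigh quotient of each nonzero [x] is a lower bound of [S], hence
   at most [M]. *)
have MS : psdmx (M%:M - A).
  apply/psdmx_scalarB => x; have := dotv_ge0 x; rewrite le_eqVlt => /orP[/eqP x0|x0].
    move/esym/eqP: x0; rewrite dotv_eq0 => /eqP ->.
    by rewrite mulmx0 -(scale0r 0) !dotvZl !mul0r mulr0.
  rewrite -ler_pdivrMr//; apply: lb_le_inf => // t /psdmx_scalarB /(_ x).
  by rewrite ler_pdivrMr.
have [ML|LM] := leP M L.
  apply/psdmx_scalarB => x; move/psdmx_scalarB: MS => /(_ x) /le_trans; apply.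
  by rewrite ler_wpM2r ?dotv_ge0.
have MA_unit : M%:M - A \in unitmx.
  apply: contraTT LM => h; rewrite -leNgt; apply: A_L.
  rewrite /eigenvalue /eigenspace kermx_eq0 row_free_unit.
  by apply: contra h; rewrite -!row_free_unit /row_free -mxrank_opp opprB.
have MA_sym : (M%:M - A)^T = M%:M - A by rewrite linearB /= tr_scalar_mx A_sym.
have [c c0 hc] := psdmx_strict MA_sym MS MA_unit.
have /(ge_inf lbS) : S (M - c).
  by move=> x; have := hc x; rewrite raddfB /= addrAC.
by rewrite -/M lerBrDr gerDl leNgt c0.
Qed.

Lemma psdmx_min_eigenvalue (R : realType) (m : nat) (A : 'M[R]_m.+1) (mu : R) :
  A^T = A -> (forall a, eigenvalue A a -> mu <= a) -> psdmx (A - mu%:M).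
Proof.
move=> A_sym A_mu.
have -> : A - mu%:M = (- mu)%:M - (- A) by rewrite opprK raddfN addrC.
apply: psdmx_max_eigenvalue => [|a]; first by rewrite linearN /= A_sym.
by rewrite eigenvalue_opp lerNr => /A_mu.
Qed.

(** * From residual polynomials to the gap of conjugate gradients *)

Section ConjugateGradient.
Context {R : realType} {m : nat}.
Variables (A : 'M[R]_m.+1) (b xs x0 : 'cV[R]_m.+1).
Hypothesis A_sym : A^T = A.
Hypothesis xs_min : argmin (quad A b) setT xs.

Lemma quad_addE (z d : 'cV[R]_m.+1) :
  quad A b (z + d) = quad A b z + dotv (A *m z - b) d + 2^-1 * dotv (A *m d) d.
Proof.
rewrite /quad mulmxDr !dotvDl !dotvDr dotvNl.
rewrite [dotv (A *m d) z]dotv_mull A_sym (dotvC d); lra.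
Qed.

(** A gradient step of length [K^-1] from [xs] lowers the objective by at least [|g|^2 / (2 K)], so
    minimality forces [g = 0]. *)
Lemma minimizer_normal_eq : A *m xs = b.
Proof.
apply/eqP; rewrite -subr_eq0 -dotv_eq0 eq_le dotv_ge0 andbT.
set g := A *m xs - b.
have [K K0 /psdmx_scalarB /(_ g) hK] := quadratic_form_bounded A.
have := xs_min.2 (xs + (- K^-1) *: g) I; rewrite quad_addE -/g.
rewrite -scalemxAr dotvZl !dotvZr -addrA lerDl => h.
have hq : dotv g g = K * (K^-1 * dotv g g) by rewrite mulrA mulfV ?gt_eqF// mul1r.
have : K^-1 * dotv (A *m g) g <= dotv g g by rewrite ler_pdivrMl.
have iK : 0 < K^-1 by rewrite invr_gt0.
have : 0 <= K^-1 * (- dotv g g + 2^-1 * (K^-1 * dotv (A *m g) g)) by lra.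
rewrite pmulr_rge0//; lra.
Qed.

Lemma quad_gapE z : quad A b z - quad A b xs = 2^-1 * dotv (A *m (z - xs)) (z - xs).
Proof.
have {1}-> : z = xs + (z - xs) by rewrite addrC subrK.
rewrite quad_addE minimizer_normal_eq subrr -(scale0r b) dotvZl; lra.
Qed.

(** The constant term of [p] cancels [e]; only the generators [A ^+ i *m e] with [i] from 1 to [k]
    remain. *)
Lemma krylov_horner (e : 'cV[R]_m.+1) (k : nat) (p : {poly R}) :
  p.[0] = 1 -> (size p <= k.+1)%N -> horner_mx A p *m e - e \in krylov A e k.
Proof.
rewrite horner_coef0 => p0 sp.
have -> : p = \sum_(i < k.+1) p`_i *: 'X^i.
  rewrite -poly_def; apply/polyP => i; rewrite coef_poly.
  by case: ltnP => // ki; rewrite nth_default // (leq_trans sp).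
rewrite rmorph_sum /= mulmx_suml big_ord_recl /= p0 scale1r rmorph1 mul1mx.
rewrite addrAC subrr add0r; apply: memv_suml => i _.
rewrite linearZ /= rmorphXn /= horner_mx_X -scalemxAl memvZ// memv_span//.
by apply/mapP; exists (bump 0 i) => //; rewrite mem_iota /bump /= add1n ltnS ltn_ord.
Qed.

Lemma cg_gap_le (y : nat -> 'cV[R]_m.+1) (k : nat) (p : {poly R}) (C : R) :
  cg_iterates A b xs x0 y -> (1 <= k)%N -> p.[0] = 1 -> (size p <= k.+1)%N ->
  psd_poly A (C%:P - 'X * p ^+ 2) ->
  quad A b (y k) - quad A b xs <= C * (dotv (x0 - xs) (x0 - xs) / 2).
Proof.
move=> y_cg k1 p0 sp hC; set e := x0 - xs.
(* This competitor is [xs + p(A) e], written as a shift of [x0] by a Krylov vector. *)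
pose z := x0 + (horner_mx A p *m e - e).
have yz : quad A b (y k) <= quad A b z.
  by apply: (y_cg k k1).2; exists (horner_mx A p *m e - e) => //=; apply: krylov_horner.
have ze : z - xs = horner_mx A p *m e by rewrite /z addrAC -/e addrC subrK.
apply: (@le_trans _ _ (quad A b z - quad A b xs)); first by rewrite lerD2r.
rewrite quad_gapE ze.
have := hC e; rewrite -/(quad_form A (C%:P - 'X * p ^+ 2) e) /quad_form rmorphB.
rewrite mulmxBl dotvDl dotvNl -/(quad_form A _ e) -/(quad_form A _ e).
rewrite quad_formC quad_form_sqr// /quad_form horner_mx_X; lra.
Qed.

End ConjugateGradient.

(** * Chebyshev polynomials and their Pell identities *)

Lemma size_linear_mul_leq (R : nzRingType) (k : nat) (l p : {poly R}) :
  (size l <= 2)%N -> (size p <= k.+1)%N -> (size (l * p)%R <= k.+2)%N.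
Proof.
move=> sl sp; apply: leq_trans (size_polyMleq _ _) _.
by rewrite -subn1 leq_subLR; apply: leq_trans (leq_add sl sp) _.
Qed.

Lemma size_polyD_leq (R : nzRingType) (k : nat) (p q : {poly R}) :
  (size p <= k)%N -> (size q <= k)%N -> (size (p + q)%R <= k)%N.
Proof. by move=> sp sq; rewrite (leq_trans (size_polyD _ _))// geq_max sp. Qed.

Lemma size_linear_leq (R : nzRingType) (a c : R) :
  (size (a%:P + c *: 'X)%R <= 2)%N.
Proof.
apply: size_polyD_leq; first exact: leq_trans (size_polyC_leq1 _) _.
by rewrite (leq_trans (size_scale_leq _ _))// size_polyX.
Qed.

(* With [c x = cos^2 t], [V (x) = cos ((2k+1)t) / cos t] and
   [W (x) = sin ((2k+1)t) / sin t]. *)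
Lemma odd_chebyshev (R : comNzRingType) (c : R) (k : nat) :
  exists V W : {poly R},
    [/\ (size V <= k.+1)%N, (size W <= k.+1)%N,
        V.[0] = (-1) ^+ k * (2 * k%:R + 1), W.[0] = (-1) ^+ k &
        (c *: 'X) * V ^+ 2 + (1 - c *: 'X) * W ^+ 2 = 1].
Proof.
elim: k => [|k [V [W [sV sW V0 W0 id1]]]].
  exists 1, 1; rewrite !size_poly1 !hornerC; split=> //.
    by rewrite mulr0 add0r mulr1.
  by rewrite expr1n !mulr1 addrC subrK.
have lin := size_linear_leq.
(* Addition formulas for [(2k+1)t + 2t], with [cos 2t = 2 c x - 1] and [sin 2t = 2 sin t cos t]. *)
exists (((-1)%:P + (2 * c) *: 'X) * V + ((-2)%:P + (2 * c) *: 'X) * W).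
exists (((-1)%:P + (2 * c) *: 'X) * W + (0%:P + (2 * c) *: 'X) * V).
split.
- by apply: size_polyD_leq; apply: size_linear_mul_leq.
- by apply: size_polyD_leq; apply: size_linear_mul_leq.
- rewrite !hornerE V0 W0 exprS -natr1; ring.
- rewrite !hornerE W0 exprS; ring.
- rewrite -[RHS]id1 -!mul_polyC !(rmorphM, rmorphN, rmorph1, rmorph0, rmorph_nat) /=.
  ring.
Qed.

(* [T] is [T_k (a - d x)] and [U] is [U_(k-1) (a - d x)]. *)
Lemma affine_chebyshev (R : comNzRingType) (a d w : R) (k : nat) :
  w ^+ 2 = a ^+ 2 - 1 ->
  exists T U : {poly R},
    [/\ (size T <= k.+1)%N, (size U <= k)%N,
        T.[0] + w * U.[0] = (a + w) ^+ k, T.[0] - w * U.[0] = (a - w) ^+ k &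
        T ^+ 2 + (1 - (a%:P - d *: 'X) ^+ 2) * U ^+ 2 = 1].
Proof.
move=> w2; elim: k => [|k [T [U [sT sU H1 H2 id1]]]].
  exists 1, 0; rewrite size_poly1 size_poly0 !hornerC !expr0 mulr0 addr0 subr0; split=> //.
  by rewrite expr1n expr0n /= mulr0 addr0.
have [x [sx xE x0]] : exists x : {poly R},
    [/\ (size x <= 2)%N, a%:P - d *: 'X = x & x.[0] = a].
  exists (a%:P - d *: 'X); rewrite -scaleNr; split=> //.
    exact: size_linear_leq.
  by rewrite !hornerE.
(* The recurrences [U_k = T_k + x U_(k-1)] and [T_(k+1) = x U_k - U_(k-1)], started from
   [U_(-1) = 0]. *)
exists (x * (T + x * U) - U), (T + x * U).
have sTU : (size (T + x * U)%R <= k.+1)%N.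
  by apply: size_polyD_leq => //; case: k sU {sT H1 H2} => [|k] sU;
    [move: sU; rewrite size_poly_leq0 => /eqP ->; rewrite mulr0 size_poly0
    | apply: size_linear_mul_leq].
split=> //.
- apply: size_polyD_leq; first exact: size_linear_mul_leq.
  by rewrite size_polyN (leq_trans sU (leqW (leqnSn k))).
- rewrite !hornerE x0 exprS -H1.
  have -> : w * (T.[0] + a * U.[0]) = w * T.[0] + w * a * U.[0] by ring.
  have -> : (a + w) * (T.[0] + w * U.[0]) = a * T.[0] + w * T.[0] + w * a * U.[0] + w ^+ 2 * U.[0] by ring.
  rewrite w2; ring.
- rewrite !hornerE x0 exprS -H2.
  have -> : (a - w) * (T.[0] - w * U.[0]) = a * T.[0] - w * T.[0] - w * a * U.[0] + w ^+ 2 * U.[0] by ring.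
  rewrite w2; ring.
- rewrite -[RHS]id1 xE; ring.
Qed.

(** * Residual polynomials for the three regimes *)

Section ResidualPolynomials.
Context {R : realType} {m : nat}.
Variables (A : 'M[R]_m.+1) (L : R).
Hypotheses (A_sym : A^T = A) (L_gt0 : 0 < L).
Hypothesis A_le : psd_poly A (L%:P - 'X).

Lemma psd_polyBr (C C' : R) (q : {poly R}) :
  C <= C' -> psd_poly A (C%:P - q) -> psd_poly A (C'%:P - q).
Proof.
move=> CC' hC; have -> : C'%:P - q = (C' - C) *: 1 + (C%:P - q).
  by rewrite alg_polyC rmorphB /= addrA subrK.
by apply: psd_polyD => //; apply: psd_polyZ (@psd_poly1 _ _ _); rewrite subr_ge0.
Qed.

Lemma normalize_residual (C a : R) (q : {poly R}) : a != 0 ->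
  (C / a ^+ 2)%:P - 'X * (a^-1 *: q) ^+ 2 = (a ^- 2) *: (C%:P - 'X * q ^+ 2).
Proof.
move=> a0; rewrite -!mul_polyC rmorphM /= -exprVn rmorphXn /=; ring.
Qed.

(** Take [c = L^-1]: multiplied by [L], the Pell identity reads [L - x V^2 = (L - x) W^2].
    Normalizing by [V(0)], of modulus [2k+1], gives the constant. *)
Lemma residual_sublinear (k : nat) :
  exists p : {poly R}, [/\ p.[0] = 1, (size p <= k.+1)%N &
    psd_poly A ((L / (2 * k%:R + 1) ^+ 2)%:P - 'X * p ^+ 2)].
Proof.
have [V [W [sV _ V0 _ id1]]] := odd_chebyshev L^-1 k.
have k0 : 0 < 2 * k%:R + 1 :> R by rewrite ltr_wpDl// mulr_ge0.
have V0n0 : V.[0] != 0 by rewrite V0 mulf_neq0 ?signr_eq0 ?gt_eqF.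
exists (V.[0]^-1 *: V); split.
- by rewrite hornerZ mulVf.
- exact: leq_trans (size_scale_leq _ _) sV.
have -> : (2 * k%:R + 1) ^+ 2 = V.[0] ^+ 2 by rewrite V0 exprMn sqrr_sign mul1r.
rewrite normalize_residual//; apply: psd_polyZ; first by rewrite invr_ge0 sqr_ge0.
suff -> : L%:P - 'X * V ^+ 2 = (L%:P - 'X) * W ^+ 2 by apply: psd_poly_sqr.
have LV : L%:P * (L^-1)%:P = 1 :> {poly R} by rewrite -polyCM mulfV ?gt_eqF.
rewrite -[X in X - _]mulr1 -[X in _ * X - _]id1 -!mul_polyC.
have -> : L%:P * ((L^-1)%:P * 'X * V ^+ 2 + (1 - (L^-1)%:P * 'X) * W ^+ 2) - 'X * V ^+ 2
  = (L%:P * (L^-1)%:P) * ('X * V ^+ 2 - 'X * W ^+ 2) + L%:P * W ^+ 2 - 'X * V ^+ 2 by ring.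
rewrite LV; ring.
Qed.

Lemma residual_linear (s : R) (k : nat) :
  0 <= s -> s < 1 -> psd_poly A ('X - (s ^+ 2 * L)%:P) ->
  exists p : {poly R}, [/\ p.[0] = 1, (size p <= k.+1)%N &
    psd_poly A ((4 * ((1 - s) / (1 + s)) ^+ (2 * k) * L)%:P - 'X * p ^+ 2)].
Proof.
move=> s0 s1 A_ge.
have s2 : 0 < 1 - s ^+ 2 by nra.
have s2n0 : 1 - s ^+ 2 != 0 by rewrite gt_eqF.
have sn0 : 1 - s != 0 by rewrite gt_eqF// subr_gt0.
have sp0 : 1 + s != 0 by rewrite gt_eqF//; lra.
have Ln0 : L != 0 by rewrite gt_eqF.
(* The map [x -> a - d x] sends [s^2 L] to 1 and [L] to -1; [w] is the square root of [a^2 - 1], so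
   [a + w] and [a - w] are [rho] and its inverse. *)
pose a := (1 + s ^+ 2) / (1 - s ^+ 2); pose w := 2 * s / (1 - s ^+ 2).
pose d := 2 / (L * (1 - s ^+ 2)).
have waE : w ^+ 2 = a ^+ 2 - 1 by rewrite /w /a; field.
have [T [U [sT _ H1 H2 id1]]] := affine_chebyshev d k waE.
pose rho := (1 + s) / (1 - s).
have rho0 : 0 < rho by rewrite divr_gt0; lra.
have awE : a + w = rho by rewrite /a /w /rho; field; apply/andP.
have T0E : T.[0] = (rho ^+ k + (a - w) ^+ k) / 2 by rewrite -H2 -awE -H1; field.
have amw0 : 0 <= a - w.
  have -> : a - w = (1 - s) / (1 + s) by rewrite /a /w; field; apply/andP.
  by rewrite divr_ge0; lra.
(* Dropping [(a - w) ^+ k] leaves the factor 1/2, whose square produces the 4 in the constant. *)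
have T0ge : rho ^+ k / 2 <= T.[0].
  by rewrite T0E; apply: ler_wpM2r; rewrite ?invr_ge0// lerDl exprn_ge0.
have T0gt : 0 < T.[0] by apply: lt_le_trans T0ge; rewrite divr_gt0 ?exprn_gt0.
exists (T.[0]^-1 *: T); split.
- by rewrite hornerZ mulVf ?gt_eqF.
- exact: leq_trans (size_scale_leq _ _) sT.
apply: (@psd_polyBr (L / T.[0] ^+ 2)).
  rewrite mulrC; apply: ler_wpM2r; first exact: ltW.
  have -> : (1 - s) / (1 + s) = rho^-1 by rewrite /rho; field; apply/andP.
  have -> : 4 * rho^-1 ^+ (2 * k) = ((rho ^+ k / 2) ^+ 2)^-1.
    rewrite mulnC exprM exprVn; field.
    by rewrite expf_neq0// gt_eqF.
  rewrite lef_pV2 ?posrE ?exprn_gt0// ?divr_gt0 ?exprn_gt0//.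
  by rewrite ler_pXn2r ?nnegrE// ?ltW// divr_gt0 ?exprn_gt0.
rewrite normalize_residual ?gt_eqF//; apply: psd_polyZ.
  by rewrite invr_ge0 sqr_ge0.
(* Split off [L (1 - T^2)], which the Pell identity turns into a weighted square. *)
have -> : L%:P - 'X * T ^+ 2 =
    (L%:P - 'X) * T ^+ 2 + L *: ((1 - (a%:P - d *: 'X) ^+ 2) * U ^+ 2).
  rewrite -mul_polyC -[X in L%:P * X](addKr (T ^+ 2)) id1; ring.
apply: psd_polyD; first exact: psd_poly_sqr.
apply: psd_polyZ; first exact: ltW.
apply: psd_poly_sqr => //.
(* The weight is [d^2 (x - s^2 L) (L - x)], put in the form [q (K - q)] required by
   [psd_poly_bound]. *)
have -> : 1 - (a%:P - d *: 'X) ^+ 2 =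
    d ^+ 2 *: (('X - (s ^+ 2 * L)%:P) * ((L - s ^+ 2 * L)%:P - ('X - (s ^+ 2 * L)%:P))).
  have c1 : 1 - a ^+ 2 = - d ^+ 2 * (s ^+ 2 * L * L).
    by rewrite /a /d; field; apply/andP.
  have c2 : 2 * a * d = d ^+ 2 * (L + s ^+ 2 * L).
    by rewrite /a /d; field; apply/andP.
  have -> : 1 - (a%:P - d *: 'X) ^+ 2 =
      (1 - a ^+ 2)%:P + (2 * a * d)%:P * 'X - (d ^+ 2)%:P * 'X ^+ 2.
    rewrite -!mul_polyC rmorphB !rmorphM rmorph1 rmorph_nat /=; ring.
  rewrite c1 c2 -mul_polyC !(rmorphM, rmorphN, rmorphD) /=; ring.
apply: psd_polyZ; first exact: sqr_ge0.
apply: psd_poly_bound => //.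
  by rewrite subr_gt0 gtr_pMl//; lra.
by rewrite rmorphB /= opprB addrA subrK.
Qed.

Lemma residual_scalar (k : nat) :
  (1 <= k)%N -> psd_poly A ('X - L%:P) ->
  exists p : {poly R}, [/\ p.[0] = 1, (size p <= k.+1)%N &
    psd_poly A (0%:P - 'X * p ^+ 2)].
Proof.
move=> k1 A_ge; exists (L^-1 *: (L%:P - 'X)); split.
- by rewrite hornerZ hornerD hornerN hornerC hornerX subr0 mulVf ?gt_eqF.
- rewrite (leq_trans (size_scale_leq _ _))// -opprB size_polyN size_XsubC.
  exact: k1.
have -> : 0%:P = (0 / L ^+ 2)%:P :> {poly R} by rewrite mul0r.
rewrite normalize_residual ?gt_eqF//; apply: psd_polyZ.
  by rewrite invr_ge0 sqr_ge0.
(* The bracket equals [- (L - x)^2]; it is positive at [A] because both [L - x] and [x - L] are,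
   using [psd_poly_bound] with [K = 1]. *)
have -> : 0%:P - 'X * (L%:P - 'X) ^+ 2 = (L%:P - 'X) * (L%:P - 'X) ^+ 2 +
   L *: ((L%:P - 'X) * (1%:P - (L%:P - 'X)) + ('X - L%:P)).
  rewrite -mul_polyC; ring.
apply: psd_polyD; first exact: psd_poly_sqr.
apply: psd_polyZ; first exact: ltW.
apply: psd_polyD => //; apply: psd_poly_bound => //.
by rewrite opprB; apply: psd_polyD => //; apply: psd_poly1.
Qed.

End ResidualPolynomials.

(** * Scalar comparison of the rates *)

Lemma sublinear_rate_le (R : realType) (s : R) (k : nat) :
  0 <= s -> s < 1 -> (1 <= k)%N ->
  let t := (1 - s) / (1 + s) in
  ((2 * k%:R + 1) ^+ 2)^-1 <= 4 / ((k%:R + 1) * (k%:R + 2)) * (1 - s ^+ 2) \/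
  4 * t ^+ (2 * k) <= 4 / ((k%:R + 1) * (k%:R + 2)) * (1 - s ^+ 2).
Proof.
move=> s_ge0 s_lt1 k_ge1 t.
have k1 : 1 <= k%:R :> R by rewrite ler1n.
set K := k%:R in k1 *.
have P0 : 0 < (K + 1) * (K + 2) by nra.
(* The threshold is sharp for the first alternative: at [k = 1] and [s^2 = 5/6] it is an
   equality. *)
have [s56|s56] := lerP (s ^+ 2) (5 / 6); [left|right].
  apply: (@le_trans _ _ (4 / ((K + 1) * (K + 2)) * 6^-1)); last first.
    by rewrite ler_wpM2l ?divr_ge0 ?(ltW P0)//; lra.
  have Q0 : 0 < (2 * K + 1) ^+ 2 by rewrite exprn_gt0//; lra.
  rewrite ler_pdivlMr// ler_pdivlMr//. rewrite -mulrA ler_pdivrMl//. nra.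
have t0 : 0 <= t by apply: divr_ge0; lra.
have s34 : 3 / 4 < s by nra.
have te : t <= (1 - s ^+ 2) / 3.
  (* Here [t = (1 - s^2) / (1 + s)^2], and [s > 3/4] makes the denominator exceed 3. *)
  rewrite /t ler_pdivrMr; last lra.
  have : 0 <= (1 - s) * ((1 + s) ^+ 2 - 3) by apply: mulr_ge0; nra.
  lra.
have t18 : t <= 18^-1 by lra.
have pk : (K + 1) * (K + 2) <= 3 * 18 ^+ k.
  rewrite /K; elim: (k) => [|j IH]; first by rewrite expr0; lra.
  have j0 : 0 <= j%:R :> R by [].
  by rewrite exprS -natr1; nra.
rewrite [leRHS]mulrAC -[leRHS]mulrA ler_pM2l// mulnC exprM expr2 -/t.
(* One factor [t^k] beats the quadratic in [k]; the other, at most [t], supplies [1 - s^2]. *)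
apply: (@le_trans _ _ (18^-1 ^+ k * ((1 - s ^+ 2) / 3))).
  rewrite ler_pM ?exprn_ge0//; first by rewrite ler_pXn2r// nnegrE invr_ge0.
  by apply: le_trans te; apply: ler_iXnr => //; lra.
rewrite ler_pdivlMr// exprVn.
have e18 : 0 < 18 ^+ k :> R by rewrite exprn_gt0.
have e0 : 0 < 1 - s ^+ 2 by nra.
rewrite -mulrA ler_pdivrMl//; nra.
Qed.

Lemma linear_rate_le (R : realType) (s : R) (k : nat) :
  0 <= s -> s < 1 -> (1 <= k)%N ->
  let t := (1 - s) / (1 + s) in
  ((2 * k%:R + 1) ^+ 2)^-1 <= (1 - s) ^+ k * (1 - s ^+ 2) \/
  4 * t ^+ (2 * k) <= (1 - s) ^+ k * (1 - s ^+ 2).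
Proof.
move=> s_ge0 s_lt1 k_ge1 t.
have k1 : 1 <= k%:R :> R by rewrite ler1n.
have P0 : 0 < (2 * k%:R + 1) ^+ 2 :> R by rewrite exprn_gt0//; lra.
have P9 : ((2 * k%:R + 1) ^+ 2)^-1 <= 4^-1 :> R.
  by rewrite lef_pV2 ?posrE//; nra.
case: k k_ge1 P9 {k1 P0} => // j _ P9.
have b0 : 0 < 1 + s by lra.
(* With [k = j + 1], this is the second alternative after cancelling [(1 - s)^(j+2)] and clearing
   denominators. *)
have [h|h] := lerP (4 * (1 - s) ^+ j) ((1 + s) ^+ (2 * j + 3)); [right|left].
  rewrite /t expr_div_n mulrA ler_pdivrMr ?exprn_gt0//.
  have -> : 4 * (1 - s) ^+ (2 * j.+1) = (1 - s) ^+ j.+2 * (4 * (1 - s) ^+ j).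
    by rewrite mulrCA -exprD; congr (_ * _ ^+ _); lia.
  have -> : (1 - s) ^+ j.+1 * (1 - s ^+ 2) * (1 + s) ^+ (2 * j.+1) =
      (1 - s) ^+ j.+2 * (1 + s) ^+ (2 * j + 3).
    have -> : (2 * j + 3 = (2 * j.+1).+1)%N by lia.
    by rewrite [in RHS]exprSr [(1 + s) ^+ _.+1]exprSr; ring.
  by rewrite ler_wpM2l// exprn_ge0//; lra.
apply: le_trans P9 _.
have b3 : (1 + s) ^+ 3 <= (1 + s) ^+ (2 * j + 3).
  by rewrite ler_weXn2l; [|lra|lia].
have p1 : (1 - s) ^+ j <= 1 by rewrite exprn_ile1//; lra.
have p0 : (1 + s) ^+ 3 / 4 <= (1 - s) ^+ j by lra.
have c4 : (1 + s) ^+ 3 < 4 by lra.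
(* Failure of the second alternative keeps [s] small enough for
   [(1 - s) (1 + s)^2 = 1 + s (1 - s - s^2)] to be at least 1. Half the square of this quantity's
   half, doubled, is the lower bound 1/4 reached below. *)
have ss : s ^+ 2 + s <= 1.
  rewrite leNgt; apply/negP => ss.
  have : 1 / 2 < s by nra.
  by move: c4; rewrite !exprS expr0 mulr1; nra.
have q1 : 1 <= (1 - s) * (1 + s) ^+ 2 by nra.
have -> : (1 - s) ^+ j.+1 * (1 - s ^+ 2) = (1 - s) ^+ j * ((1 - s) ^+ 2 * (1 + s)).
  by rewrite exprS; ring.
apply: (@le_trans _ _ ((1 + s) ^+ 3 / 4 * ((1 - s) ^+ 2 * (1 + s)))).
  have -> : (1 + s) ^+ 3 / 4 * ((1 - s) ^+ 2 * (1 + s)) =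
    ((1 - s) * (1 + s) ^+ 2) ^+ 2 / 4 by field.
  by nra.
by rewrite ler_wpM2r// mulr_ge0 ?sqr_ge0// ltW.
Qed.

Theorem mainTheorem2 (R : realType) (n : nat) (A : 'M[R]_n) (mu L : R)
    (b xs x0 : 'cV[R]_n) (y : nat -> 'cV[R]_n)
    (A_sym : A^T = A) (A_psd : psdmx A)
    (A_mu : min_eigenvalue A mu) (mu_ge0 : 0 <= mu)
    (A_L : max_eigenvalue A L) (L_gt0 : 0 < L)
    (xs_min : argmin (quad A b) setT xs)
    (y_cg : cg_iterates A b xs x0 y)
    (k : nat) (k_ge1 : (1 <= k)%N) :
  quad A b (y k) - quad A b xs <=
    Num.min (4 / ((k%:R + 1) * (k%:R + 2))) ((1 - Num.sqrt (mu / L)) ^+ k)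
    * ((L - mu) * enorm (xs - x0) ^+ 2 / 2).
Proof.
(* Dimension zero is excluded by the existence of an eigenvalue. *)
case: n => [|m] in A b xs x0 y A_sym A_psd A_mu A_L xs_min y_cg *.
  by case: A_mu.1; rewrite /eigenvalue thinmx0 eqxx.
have A_le : psd_poly A (L%:P - 'X).
  rewrite /psd_poly rmorphB /= horner_mx_C horner_mx_X.
  exact: psdmx_max_eigenvalue A_L.2.
have A_ge : psd_poly A ('X - mu%:P).
  rewrite /psd_poly rmorphB /= horner_mx_C horner_mx_X.
  exact: psdmx_min_eigenvalue A_mu.2.
have muL : mu <= L := A_mu.2 _ A_L.1.
set s := Num.sqrt (mu / L).
have s0 : 0 <= s := sqrtr_ge0 _.
have s2 : s ^+ 2 * L = mu.
  by rewrite sqr_sqrtr ?divr_ge0 ?(ltW L_gt0)// divfK ?gt_eqF.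
have s1 : s <= 1 by rewrite -sqrtr1 ler_sqrt// ler_pdivrMr// mul1r.
have -> : enorm (xs - x0) ^+ 2 = dotv (x0 - xs) (x0 - xs).
  by rewrite enormK -opprB dotvNl dotvC dotvNl opprK.
rewrite -[(L - mu) * _ / 2]mulrA; set E := dotv _ _ / 2.
have E0 : 0 <= E by rewrite divr_ge0 ?dotv_ge0.
set gap := _ - _.
have gap_le C : (exists p : {poly R}, [/\ p.[0] = 1, (size p <= k.+1)%N &
    psd_poly A (C%:P - 'X * p ^+ 2)]) -> gap <= C * E.
  by case=> p [p0 sp hp]; apply: cg_gap_le p0 sp hp.
have muE : L - mu = (1 - s ^+ 2) * L by rewrite -s2; ring.
(* Here [r] stands for either entry of the minimum; the factor [1 - s^2] comes from [L - mu]. *)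
suff rates r : (s < 1 -> ((2 * k%:R + 1) ^+ 2)^-1 <= r * (1 - s ^+ 2) \/
    4 * ((1 - s) / (1 + s)) ^+ (2 * k) <= r * (1 - s ^+ 2)) ->
    gap <= r * ((L - mu) * E).
  by rewrite minEle; case: ifP => _; apply: rates => lt_s1;
    [apply: sublinear_rate_le | apply: linear_rate_le].
move=> hr; have LE : 0 <= L * E by rewrite mulr_ge0// ltW.
(* If [mu = L] the right-hand side vanishes, so the residual constant must be 0. *)
have [s_eq1|s_neq1] := eqVneq s 1.
  have mu_L : mu = L by rewrite -s2 s_eq1 expr1n mul1r.
  rewrite mu_L subrr mul0r mulr0 -(mul0r E); apply: gap_le.
  by apply: (@residual_scalar _ _ _ L) => //; rewrite -mu_L.
have lt_s1 : s < 1 by rewrite lt_neqAle s_neq1.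
have -> : r * ((L - mu) * E) = r * (1 - s ^+ 2) * (L * E) by rewrite muE; ring.
case: (hr lt_s1) => /(ler_wpM2r LE) h; apply: (le_trans _ h); rewrite mulrA; apply: gap_le.
  by rewrite mulrC; apply: residual_sublinear.
by apply: residual_linear => //; rewrite s2.
Qed.
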